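(* Let $X$ be a $\mathcal{B}$ real Banach space, $C$ a nonempty closed convex subset of $X$, $N\ge1$ an integer, and $Q_l:C\to C$, $l\in\{0,\ldots,N-1\}$, a family of nonexpansive mappings. Put $T_n:=Q_{n\bmod N}$ for $n\in\mathbb{N}$. Suppose that $F:=\bigcap_{l=0}^{N-1}\mathrm{Fix}(Q_l)$ is not empty and that $$\bigcap_{l=0}^{N-1}\mathrm{Fix}(Q_l)=\mathrm{Fix}(T_{n+N}T_{n+N-1}\cdots T_{n+1})\quad\text{for all } n\in\mathbb{N}.$$ Let $f:C\to C$ be an $\alpha$-contraction for some $\alpha\in(0,1)$. Let $\{\alpha_n\}$ be a sequence of real numbers such that: (i) $\alpha_n\in(0,1)$ for all $n$; (ii) $\lim_{n\to\infty}\alpha_n=0$; (iii) $\sum_{n=0}^\infty\alpha_n=\infty$; and either (iv) $\sum_{n=0}^\infty|\alpha_{n+N}-\alpha_n|<\infty$ or (iv') $\lim_{n\to\infty}\alpha_{n+N}/\alpha_n=1$. Let $x_0\in C$ and $$x_{n+1}=\alpha_nf(x_n)+(1-\alpha_n)T_nx_n .$$ Then $\{x_n\}$ converges strongly to $\mathbf{Q}_F(f)$.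
   Context: A mapping $T:C\to C$ is nonexpansive if $\|Tx-Ty\|\le\|x-y\|$ for all $x,y\in C$; $f:C\to C$ is an $\alpha$-contraction ($\alpha\in(0,1)$) if $\|f(x)-f(y)\|\le\alpha\|x-y\|$ for all $x,y\in C$. $\mathrm{Fix}(T)=\{x\in C: Tx=x\}$. Products of mappings are compositions. The normalized duality map is $J(x)=\{x^\star\in X^\star:\langle x,x^\star\rangle=\|x\|^2=\|x^\star\|^2\}$. A ''$\mathcal{B}$ real Banach space'' is a real Banach space $X$ such that either (a) the normalized duality mapping $J$ is (single-valued and) uniformly norm-to-weak$^\star$ continuous on bounded sets, or (b) $X$ is reflexive and admits a weakly continuous duality mapping $J_\phi$ with gauge $\phi$, i.e. $\phi:[0,\infty)\to[0,\infty)$ is continuous, strictly increasing, $\phi(0)=0$, $\phi(t)\to\infty$ as $t\to\infty$, and $J_\phi(x)=\{x^\star\in X^\star:\langle x,x^\star\rangle=\|x\|\phi(\|x\|),\ \|x^\star\|=\phi(\|x\|)\}$ is single-valued and weak-to-weak$^\star$ sequentially continuous. Definition of $\mathbf{Q}_F(f)$: let $T:C\to C$ be nonexpansive with $\mathrm{Fix}(T)=F$. For $u\in C$ and $t\in(0,1)$ let $z_t\in C$ be the unique fixed point of $x\mapsto tu+(1-t)Tx$, and let $R_T(u)=\lim_{t\to0}z_t$ (strong limit). Then $R_T$ is the unique sunny nonexpansive retraction of $C$ onto $F$ (so it depends only on $F$), and $\mathbf{Q}_F(f)$ is the unique fixed point $\tilde x=R_T(f(\tilde x))$ of the contraction $R_T\circ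 f$. Here this is applied to the mappings $T=T_{n+N}T_{n+N-1}\cdots T_{n+1}$, and it is understood that for these mappings the limit exists for every $u\in C$. *)

(* Defs.v *)
From HB Require Import structures.
From mathcomp Require Import all_boot all_order all_algebra.
From mathcomp Require Import all_classical all_reals all_analysis.

Set Implicit Arguments.
Unset Strict Implicit.
Unset Printing Implicit Defensive.
Import Order.TTheory GRing.Theory Num.Theory.
Import numFieldNormedType.Exports.
Local Open Scope classical_set_scope.
Local Open Scope ring_scope.

Section Duality.
Context {R : realType} (X : normedModType R).

Definition dual : set (X -> R) := [set g : X -> R | scalar g /\ continuous g].

Definition dual_norm (g : X -> R) : R := sup [set `|g x| | x in [set x | `|x| <= 1]].

(* Elements of X** are encoded as functions on X -> R; only their values on
   [dual] matter. *)
Definition bidual : set ((X -> R) -> R) :=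
  [set Phi |
    (forall (a : R) (g h : X -> R), dual g -> dual h ->
       Phi (fun y : X => a * g y + h y) = a * Phi g + Phi h)
    /\ exists K : R, forall g, dual g -> `|Phi g| <= K * dual_norm g].

Definition reflexive_space : Prop :=
  forall Phi, bidual Phi -> exists x : X, forall g, dual g -> Phi g = g x.

Definition normalized_duality (x : X) : set (X -> R) :=
  [set g | [/\ dual g, g x = `|x| ^+ 2 & dual_norm g ^+ 2 = `|x| ^+ 2]].

Definition gauge_fun (phi : R -> R) : Prop :=
  [/\ {within `[0, +oo[, continuous phi},
      {in `[0, +oo[ &, {homo phi : s t / s < t}},
      phi 0 = 0
    & phi t @[t --> +oo] --> +oo].

Definition gauge_duality (phi : R -> R) (x : X) : set (X -> R) :=
  [set g | [/\ dual g, g x = `|x| * phi `|x| & dual_norm g = phi `|x|]].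

(* The seminorms g |-> |g y| generate the weak-star uniformity, so it suffices
   to test one y at a time. *)
Definition unif_norm_weakstar_continuous_on_bounded (j : X -> X -> R) : Prop :=
  forall B : set X, bounded_set B ->
  forall (y : X) (e : R), 0 < e ->
  exists2 d : R, 0 < d &
    forall x x', B x -> B x' -> `|x - x'| < d -> `|j x y - j x' y| < e.

Definition weak_cvg (u : nat -> X) (x : X) : Prop :=
  forall g, dual g -> g (u n) @[n --> \oo] --> g x.

Definition weak_weakstar_seq_continuous (j : X -> X -> R) : Prop :=
  forall (u : nat -> X) (x : X), weak_cvg u x ->
  forall y, j (u n) y @[n --> \oo] --> j x y.

Definition B_space : Prop :=
  (exists2 j : X -> X -> R,
      forall x, normalized_duality x = [set j x]
    & unif_norm_weakstar_continuous_on_bounded j)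
  \/
  (reflexive_space /\
   exists2 phi, gauge_fun phi &
   exists2 j : X -> X -> R,
      forall x, gauge_duality phi x = [set j x]
    & weak_weakstar_seq_continuous j).

End Duality.

(* A mapping C -> C is encoded as a total function X -> X preserving C. *)
Section Mappings.
Context {R : realType} {X : completeNormedModType R}.
Implicit Types (C F : set X) (T f : X -> X).

Definition nonexpansive C T : Prop := set_fun C C T /\ 1.-lipschitz_C T.

Definition alpha_contraction (a : R) C f : Prop :=
  [/\ 0 < a < 1, set_fun C C f & a.-lipschitz_C f].

Definition Fix C T : set X := [set x | C x /\ T x = x].

(* The point z_t; meaningful for 0 < t < 1, where the fixed point exists and is
   unique. *)
Definition approx_fixpoint C T (u : X) (t : R) : X :=
  get [set z | C z /\ z = t *: u + (1 - t) *: T z].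

Definition retraction C T (u : X) : X :=
  lim (approx_fixpoint C T u t @[t --> 0^'+]).

Definition retraction_exists C T : Prop :=
  forall u, C u -> cvg (approx_fixpoint C T u t @[t --> 0^'+]).

Definition represents C F T : Prop :=
  [/\ nonexpansive C T, Fix C T = F & retraction_exists C T].

(* q = Q_F(f): a representing T exists, and q is the unique fixed point of
   R_T \o f for every such T, since R_T depends only on F. *)
Definition is_QF C F f (q : X) : Prop :=
  (exists T, represents C F T) /\
  (forall T, represents C F T -> Fix C (retraction C T \o f) = [set q]).

(* compose_from T n k = T (n + k) \o ... \o T (n + 1) *)
Fixpoint compose_from (T : nat -> X -> X) (n k : nat) : X -> X :=
  if k is k'.+1 then T (n + k'.+1)%N \o compose_from T n k' else idfun.

Definition cyclic_family (N : nat) (N_gt0 : (0 < N)%N) (Q : 'I_N -> X -> X)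
    (n : nat) : X -> X :=
  Q (Ordinal (ltn_pmod n N_gt0)).

End Mappings.

(* Main.v *)
(**
Everything rests on a selection [j] of the normalized duality map which is
odd and uniformly norm-to-weak-star continuous on bounded sets.  In case (a) it
is given.  In case (b) put [j x = |x| / phi |x| * j_phi x]: were uniform
continuity to fail along bounded sequences [a_n], [b_n] with [a_n - b_n -> 0],
reflexivity would give a subsequence along which both converge weakly to the
same point and have convergent norms, against the weak continuity of [j_phi].

For nonexpansive [W] and [z = t u + (1 - t) W z] one has
[t j(x - z)(u - z) <= |x - z| |x - W x|].  With [x] a fixed point and [t -> 0]
this yields [j(p - R u)(u - R u) <= 0] for all [p] in [F], which determines
[R u] from [F] alone and makes [R] nonexpansive.  With [x = x_{n+1}], which is
asymptotically fixed by [T_{n+N} ... T_{n+1}], it yields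
[limsup j(x_{n+1} - q)(f q - q) <= 0], where [q = R (f q)]; strong convergence
then follows from Xu's lemma on recursive inequalities.
*)

Require Import Defs.
From HB Require Import structures.
From mathcomp Require Import all_boot all_order all_algebra.
From mathcomp Require Import all_classical all_reals all_analysis.
From mathcomp Require Import ring lra.
Import Order.TTheory GRing.Theory Num.Theory.
Import numFieldNormedType.Exports.
Local Open Scope classical_set_scope.
Local Open Scope ring_scope.
Set Implicit Arguments.
Unset Strict Implicit.
Unset Printing Implicit Defensive.

(** * The Hahn-Banach theorem *)

Section HahnBanach.
Context {R : realType} {V : lmodType R}.
Implicit Types (p q : V -> R) (c t : R).

Record sublinear p : Prop := Sublinear {
  sublinearD : forall v w, p (v + w) <= p v + p w;
  sublinearZ : forall c v, 0 <= c -> p (c *: v) = c * p v }.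

Lemma sublinear0 p : sublinear p -> p 0 = 0.
Proof. by move=> sp; rewrite -(scale0r 0) (sublinearZ sp) ?mul0r. Qed.

Lemma sublinear_geN p v : sublinear p -> - p (- v) <= p v.
Proof.
move=> sp; have := sublinearD sp v (- v).
by rewrite subrr sublinear0 //; lra.
Qed.

Lemma inf_le (A : set R) x y : has_lbound A -> A x -> x <= y -> inf A <= y.
Proof. by move=> lA Ax; apply: le_trans; exact: ge_inf. Qed.

(* Tilting lowers p so as to force additivity in the direction a. *)
Let tilt p a v : R := inf [set p (v + t *: a) - t * p a | t in [set t | 0 <= t]].

Let tilt_lb p a v t : sublinear p -> 0 <= t -> - p (- v) <= p (v + t *: a) - t * p a.
Proof.
move=> sp t0; have := sublinearD sp (v + t *: a) (- v).
by rewrite (addrAC v) subrr add0r (sublinearZ sp) //; lra.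
Qed.

Let tilt_has_lb p a v : sublinear p ->
  has_lbound [set p (v + t *: a) - t * p a | t in [set t | 0 <= t]].
Proof. by move=> sp; exists (- p (- v)) => _ [t t0 <-]; exact: tilt_lb. Qed.

Let tilt_le p a v t : sublinear p -> 0 <= t ->
  tilt p a v <= p (v + t *: a) - t * p a.
Proof. by move=> sp t0; apply: ge_inf; [exact: tilt_has_lb|exists t]. Qed.

Let tilt_ge p a v b : (forall t, 0 <= t -> b <= p (v + t *: a) - t * p a) ->
  b <= tilt p a v.
Proof.
move=> h; apply: lb_le_inf; first by exists (p (v + 0 *: a) - 0 * p a); exists 0 => /=.
by move=> _ [t t0 <-]; exact: h.
Qed.

Let tilt_sublinear p a : sublinear p -> sublinear (tilt p a).
Proof.
move=> sp; split=> [v w|c v].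
  rewrite -lerBlDr; apply: tilt_ge => t t0.
  rewrite lerBlDr [leRHS]addrC -lerBlDr; apply: tilt_ge => s s0.
  rewrite lerBlDr; apply: (le_trans (tilt_le a (v + w) sp (addr_ge0 t0 s0))).
  have := sublinearD sp (v + t *: a) (w + s *: a).
  by rewrite addrACA -scalerDl; lra.
rewrite le_eqVlt => /orP[/eqP<-|c0].
  rewrite mul0r scale0r; apply/eqP; rewrite eq_le; apply/andP; split.
    apply: le_trans (tilt_le a _ sp (lexx _)) _.
    by rewrite scale0r addr0 mul0r subr0 sublinear0.
  by apply: tilt_ge => t t0; have := tilt_lb a 0 sp t0; rewrite oppr0 sublinear0// oppr0.
apply/eqP; rewrite eq_le; apply/andP; split.
  rewrite -ler_pdivrMl //; apply: tilt_ge => t t0; rewrite ler_pdivrMl //.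
  apply: (le_trans (tilt_le a _ sp (mulr_ge0 (ltW c0) t0))).
  by rewrite -scalerA -scalerDr (sublinearZ sp) ?(ltW c0)// mulrBr mulrA.
apply: tilt_ge => t t0.
have -> : c *: v + t *: a = c *: (v + (t / c) *: a).
  by rewrite scalerDr scalerA mulrC divfK ?gt_eqF.
rewrite (sublinearZ sp) ?(ltW c0)//.
have -> : t * p a = c * (t / c * p a) by rewrite mulrA [c * _]mulrC divfK ?gt_eqF.
by rewrite -mulrBr ler_pM2l// tilt_le// divr_ge0// ltW.
Qed.

Let tilt_le_self p a v : sublinear p -> tilt p a v <= p v.
Proof.
move=> sp; apply: le_trans (tilt_le a _ sp (lexx _)) _.
by rewrite scale0r addr0 mul0r subr0.
Qed.

(* A minimal sublinear functional is linear, since tilting cannot decrease it;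
   this avoids extending functionals from subspaces. *)
Let min_sublinear p : sublinear p -> exists q, [/\ sublinear q, forall v, q v <= p v &
  forall r, sublinear r -> (forall v, r v <= q v) -> r = q].
Proof.
move=> sp; pose P := {q : V -> R | sublinear q /\ forall v, q v <= p v}.
pose le (q1 q2 : P) := `[< forall v, sval q2 v <= sval q1 v >].
have [| | |A Atot|[q [sq qp]] qmin] := @Zorn P le.
- by move=> t; apply/asboolP.
- by move=> r s t /asboolP rs /asboolP st; apply/asboolP => v; apply: le_trans (rs v).
- move=> [s Ps] [t Pt] /asboolP/= st /asboolP/= ts; apply: eq_exist.
  by apply/funext => v; apply/eqP; rewrite eq_le st ts.
- have [[q0 Aq0]|A0] := pselect (A !=set0); last first.
    by exists (exist _ p (conj sp (fun=> lexx _))) => s As; case: A0; exists s.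
  (* A nonempty chain is bounded in the order [le] by its pointwise infimum, finite because
     [- p (- v)] is a common lower bound. *)
  pose E v := [set sval q v | q in A].
  have lbE v : has_lbound (E v).
    exists (- p (- v)) => _ [[q [sq qp]] _ <-] /=.
    by apply: le_trans (sublinear_geN v sq); rewrite lerN2.
  have E0 v : E v !=set0 by exists (sval q0 v); exists q0.
  pose m v := inf (E v).
  have sm : sublinear m.
    split=> [v w|c v].
      rewrite -lerBlDr; apply: lb_le_inf => // _ [q1 Aq1 <-].
      rewrite lerBlDr [leRHS]addrC -lerBlDr; apply: lb_le_inf => // _ [q2 Aq2 <-].
      rewrite lerBlDr.
      (* Subadditivity of the infimum needs one member for both arguments: by the chain condition,
         one of [q1] and [q2] is below the other everywhere. *)
      have key (q : P) : A q -> m (v + w) <= sval q v + sval q w.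
        move=> Aq; apply: le_trans (sublinearD (proj1 (svalP q)) _ _).
        by apply: ge_inf => //; exists q.
      have [/asboolP q12|/asboolP q21] := Atot _ _ Aq1 Aq2.
        by apply: (le_trans (key _ Aq2)); rewrite addrC lerD2l.
      by apply: (le_trans (key _ Aq1)); rewrite addrC lerD2r.
    rewrite le_eqVlt => /orP[/eqP<-|c0].
      rewrite mul0r scale0r /m.
      suff -> : E 0 = [set 0] by rewrite inf1.
      apply/seteqP; split=> [_ [q _ <-]|_ ->] /=; first by rewrite (sublinear0 (proj1 (svalP q))).
      by exists q0 => //; rewrite (sublinear0 (proj1 (svalP q0))).
    apply/eqP; rewrite eq_le; apply/andP; split.
      rewrite -ler_pdivrMl //; apply: lb_le_inf => // _ [q Aq <-].
      rewrite ler_pdivrMl// -(sublinearZ (proj1 (svalP q))) ?(ltW c0)//.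
      by apply: ge_inf => //; exists q.
    apply: lb_le_inf => // _ [q Aq <-].
    rewrite (sublinearZ (proj1 (svalP q))) ?(ltW c0)// ler_pM2l//.
    by apply: ge_inf => //; exists q.
  have mp v : m v <= p v.
    by apply: inf_le (lbE v) _ (proj2 (svalP q0) v); exists q0.
  exists (exist _ m (conj sm mp)) => s As; apply/asboolP => v /=.
  by apply: ge_inf => //; exists s.
exists q; split=> // r sr rq.
have rp v : r v <= p v by exact: le_trans (qp v).
have := qmin (exist _ r (conj sr rp)).
by move=> h; have /(congr1 sval) : _ := h (asboolT rq).
Qed.

(** Take [g] minimal below [tilt p w]. Tilting leaves it unchanged, so [g] is additive, hence
    linear; evaluating [tilt p w] at [- w] with [t = 1] gives [g (- w) <= - p w]. *)
Lemma hahn_banach p w : sublinear p ->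
  exists g : V -> R, [/\ scalar g, forall v, g v <= p v & g w = p w].
Proof.
move=> sp; have [g [sg gp gmin]] := min_sublinear (tilt_sublinear w sp).
have gle v : g v <= p v by apply: le_trans (gp v) (tilt_le_self _ _ sp).
have tiltg a : tilt g a = g.
  by apply: gmin; [exact: tilt_sublinear|move=> v; exact: tilt_le_self].
have gD v a : g (v + a) = g v + g a.
  apply/eqP; rewrite eq_le (sublinearD sg) /= -lerBrDr.
  rewrite -{1}(tiltg a); apply: le_trans (tilt_le a v sg ler01) _.
  by rewrite scale1r mul1r.
have gN v : g (- v) = - g v.
  by apply/eqP; rewrite -addr_eq0 -gD addNr sublinear0.
exists g; split=> //.
  move=> c u v; rewrite gD; congr (_ + _).
  have [c0|/ltW c0] := leP 0 c; first exact: sublinearZ.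
  rewrite -[c]opprK scaleNr gN (sublinearZ sg) ?oppr_ge0//; ring.
apply/eqP; rewrite eq_le gle /=.
rewrite -lerN2 -gN; apply: le_trans (gp _) _.
apply: le_trans (tilt_le w _ sp ler01) _.
by rewrite scale1r addNr sublinear0// sub0r mul1r.
Qed.

End HahnBanach.

(** * Weak compactness in reflexive spaces *)

Section ScalarFunctional.
Context {R : realType} {V : lmodType R} {g : V -> R} (sg : scalar g).

Lemma scalarfD v w : g (v + w) = g v + g w.
Proof. by have := sg 1 v w; rewrite scale1r mul1r. Qed.

Lemma scalarf0 : g 0 = 0.
Proof. by have := scalarfD 0 0; rewrite addr0; lra. Qed.

Lemma scalarfZ c v : g (c *: v) = c * g v.
Proof. by have := sg c v 0; rewrite !addr0 scalarf0 addr0. Qed.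

Lemma scalarfN v : g (- v) = - g v.
Proof. by rewrite -scaleN1r scalarfZ mulN1r. Qed.

Lemma scalarfB v w : g (v - w) = g v - g w.
Proof. by rewrite scalarfD scalarfN. Qed.

End ScalarFunctional.

(** * Bounded linear functionals and the dual norm *)

Section Dual.
Context {R : realType} {X : normedModType R}.
Implicit Types (g : X -> R) (x y : X).

(** Continuity at 0 bounds [g] by 1 on a ball of radius [d]; every nonzero vector is rescaled to
    norm [d / 2]. *)
Lemma dual_bounded g : dual g -> exists2 K, 0 < K & forall x, `|g x| <= K * `|x|.
Proof.
move=> [sg cg].
have /cvgrPdist_lt/(_ 1 ltr01) := cg 0.
rewrite -nbhs_nearE => /nbhs_ballP[d /= d0 dP].
exists (2 / d); first by rewrite divr_gt0.
move=> x; have [->|x0] := eqVneq x 0; first by rewrite scalarf0// !normr0 mulr0.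
have nx : 0 < `|x| by rewrite normr_gt0.
pose c := d / (2 * `|x|).
have c0 : 0 < c by rewrite divr_gt0// mulr_gt0.
have := dP (c *: x); rewrite -ball_normE /= sub0r normrN normrZ gtr0_norm//.
have -> : c * `|x| = d / 2 by rewrite /c; field; rewrite gt_eqF.
rewrite ltr_pdivrMr// ltr_pMr// ltr1n => /(_ isT).
rewrite scalarf0// sub0r normrN scalarfZ// normrM gtr0_norm// => gx.
have -> : 2 / d * `|x| = c^-1 by rewrite /c; field; rewrite !gt_eqF.
by rewrite -[leRHS]mulr1 ler_pdivlMl// ltW.
Qed.

Lemma boundedW_dual g K : scalar g -> (forall x, `|g x| <= K * `|x|) -> dual g.
Proof.
move=> sg gK; split=> // x; apply/cvgrPdist_lt => e e0.
have K1 : 0 < `|K| + 1 by rewrite ltr_wpDl.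
near=> y; rewrite -scalarfB//.
apply: (le_lt_trans (gK _)); apply: (@le_lt_trans _ _ ((`|K| + 1) * `|x - y|)).
  by rewrite ler_wpM2r// (le_trans (ler_norm K))// lerDl.
rewrite -ltr_pdivlMl//; near: y.
by apply: cvgr_dist_lt => //; rewrite mulr_gt0// invr_gt0.
Unshelve. all: by end_near. Qed.

Lemma dual_norm_ge g x : dual g -> `|g x| <= dual_norm g * `|x|.
Proof.
move=> dg; have [K K0 gK] := dual_bounded dg; have sg := dg.1.
have [->|x0] := eqVneq x 0; first by rewrite scalarf0// !normr0 mulr0.
have nx : 0 < `|x| by rewrite normr_gt0.
(* The constant [K] makes the set of values bounded, so that its [sup] is an upper bound. *)
rewrite -ler_pdivrMr//; apply: ub_le_sup.
  exists K => _ [y /= y1 <-]; apply: (le_trans (gK y)).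
  by rewrite ler_piMr// ltW.
exists (`|x|^-1 *: x) => /=.
  by rewrite normrZ normfV normr_id mulVf// gt_eqF.
by rewrite scalarfZ// normrM normfV normr_id mulrC.
Qed.

Lemma dual_norm_ge0 g : dual g -> 0 <= dual_norm g.
Proof.
move=> dg; have [K K0 gK] := dual_bounded dg.
apply: ub_le_sup; first by exists K => _ [y /= y1 <-]; apply: (le_trans (gK y)); rewrite ler_piMr// ltW.
by exists 0; rewrite /= ?normr0// scalarf0 ?normr0//; case: dg.
Qed.

Lemma dual_normN g : dual_norm (fun x => - g x) = dual_norm g.
Proof. by congr sup; apply: eq_imagel => x _; rewrite normrN. Qed.

Lemma dualN g : dual g -> dual (fun x => - g x).
Proof.
move=> dg; have [K _ gK] := dual_bounded dg; apply: (@boundedW_dual _ K).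
  by move=> a x y; rewrite dg.1 opprD mulrN.
by move=> x; rewrite normrN.
Qed.

End Dual.

(** * Limits along ultrafilters and extraction of subsequences *)

(** Compactness of [[- K, K]] yields a cluster point, and an ultrafilter converges to each of its
    cluster points. *)
Lemma ultrafilter_bounded_cvg {R : realType} {T : Type} (F : set_system T) (h : T -> R) (K : R) :
  UltraFilter F -> (forall t, `|h t| <= K) -> cvg (h @ F).
Proof.
move=> UF hK.
have FA : (h @ F) [set` `[- K, K]].
  suff : F (h @^-1` [set` `[- K, K]]) by [].
  apply: (filterS _ (@filterT _ F _)) => t _ /=.
  by rewrite in_itv /= -ler_norml.
have [p [_ clp]] := @segment_compact R (- K) K (h @ F) _ FA.
apply/cvg_ex; exists p => B nB.
have [//|FnB] := @in_ultra_setVsetC _ F (h @^-1` B) UF.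
by have [z []] := clp (~` B) B FnB nB.
Qed.

(** Diagonal choice: stage [k] only asks for [k + 1] conditions and an index at least [k], a finite
    intersection of members of [F]. *)
Lemma ultrafilter_cvg_subseq {R : realType} (F : set_system nat) (h : nat -> nat -> R)
    (c : nat -> R) :
  ProperFilter F -> \oo `<=` F -> (forall i, h i n @[n --> F] --> c i) ->
  exists2 s : nat -> nat, forall k, (k <= s k)%N &
    forall i, h i (s k) @[k --> \oo] --> c i.
Proof.
move=> FF ooF hc.
have ex k : exists n, (k <= n)%N /\ forall i, (i < k.+1)%N -> `|c i - h i n| < k.+1%:R^-1.
  apply: (@filter_ex _ F); apply: filterI.
    by apply: ooF; exists k => // n /=.
  have : \forall n \near F, forall i : 'I_k.+1, `|c i - h i n| < k.+1%:R^-1.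
    apply: filter_forall => i.
    by have /cvgrPdist_lt := hc i; apply; rewrite invr_gt0.
  by apply: filterS => n nP i ik; exact: (nP (Ordinal ik)).
have [s sP] := choice ex; exists s => [k|i]; first by case: (sP k).
apply/cvgrPdist_lt => e e0; near=> k.
have [_ /(_ i)] := sP k; rewrite ltnS => /(_ _)/lt_trans; apply.
  by near: k; exists i.
near: k; exact: near_infty_natSinv_lt (PosNum e0).
Unshelve. all: by end_near. Qed.

(** * Weakly convergent subsequences of bounded sequences *)

Section WeakCompactness.
Context {R : realType} {X : normedModType R}.
Implicit Types (u : nat -> X) (x y : X).

(** The limit along [F] exists on every functional and defines an element of the bidual of norm at
    most [M]; reflexivity represents it by a point. *)
Lemma reflexive_ultrafilter_cvg u M (F : set_system nat) :
  @reflexive_space R X -> UltraFilter F -> (forall n, `|u n| <= M) ->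
  exists x, forall g, dual g -> g (u n) @[n --> F] --> g x.
Proof.
move=> refl UF uM; pose Phi (g : X -> R) : R := lim (g (u n) @[n --> F]).
have cvgF g : dual g -> g (u n) @[n --> F] --> Phi g.
  move=> dg; apply: (@ultrafilter_bounded_cvg _ _ _ _ (dual_norm g * M)) => n.
  by apply: (le_trans (dual_norm_ge _ dg)); rewrite ler_wpM2l// dual_norm_ge0.
have [x xP] : exists x, forall g, dual g -> Phi g = g x.
  apply: refl; split=> [a g h dg dh|].
    by apply: cvg_lim => //; apply: cvgD; [apply: cvgMl_tmp|]; exact: cvgF.
  exists M => g dg; apply: (cvgr_to_le (cvg_norm (cvgF _ dg))).
  apply: nearW => n; apply: (le_trans (dual_norm_ge _ dg)).
  by rewrite mulrC ler_wpM2r// dual_norm_ge0.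
by exists x => g dg; rewrite -xP//; exact: cvgF.
Qed.

(** Coefficients and indices are kept in a list, so that sums are concatenations and the rational
    combinations are countable. *)
Definition lincomb u (l : seq (R * nat)) : X := \sum_(p <- l) p.1 *: u p.2.

Lemma lincomb_cat u k l : lincomb u (k ++ l) = lincomb u k + lincomb u l.
Proof. exact: big_cat. Qed.

Lemma lincombZ u c l : lincomb u [seq (c * p.1, p.2) | p <- l] = c *: lincomb u l.
Proof.
by rewrite /lincomb big_map scaler_sumr; apply: eq_bigr => p _; rewrite scalerA.
Qed.

Lemma rational_lincomb_dense u l e : 0 < e ->
  exists k : seq (rat * nat),
    `|lincomb u l - lincomb u [seq (ratr p.1, p.2) | p <- k]| < e.
Proof.
elim: l e => [|[c i] l IH] e e0; first by exists [::]; rewrite subrr normr0.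
have e2 : 0 < e / 2 by rewrite divr_gt0.
have [k kP] := IH _ e2.
have M0 : 0 < `|u i| + 1 by rewrite ltr_wpDl.
(* Tolerance for the head coefficient; the [+ 1] covers the case [u i = 0]. *)
have d0 : 0 < e / 2 / (`|u i| + 1) by rewrite divr_gt0.
have /rat_in_itvoo[q] : c - e / 2 / (`|u i| + 1) < c + e / 2 / (`|u i| + 1) by lra.
rewrite in_itv /= => qP.
exists ((q, i) :: k); rewrite /= /lincomb !big_cons /= -!/(lincomb _ _).
rewrite opprD addrACA -scalerBl [e]splitr.
apply: (le_lt_trans (ler_normD _ _)); apply: ltrD => //.
rewrite normrZ; apply: (@le_lt_trans _ _ (`|c - ratr q| * (`|u i| + 1))).
  by rewrite ler_wpM2l// lerDl.
by rewrite -ltr_pdivlMr// ltr_norml; lra.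
Qed.

(** Distance to the span of the [u n]: a sublinear functional vanishing on the span, suited as a
    Hahn-Banach majorant. *)
Definition dist_span u x : R := inf [set `|x - lincomb u l| | l in setT].

Lemma dist_span_le u x l : dist_span u x <= `|x - lincomb u l|.
Proof. by apply: ge_inf; [exists 0 => _ [k _ <-]|exists l]. Qed.

Lemma dist_span_ge u x b : (forall l, b <= `|x - lincomb u l|) -> b <= dist_span u x.
Proof.
by move=> h; apply: lb_le_inf; [exists `|x - lincomb u [::]|; exists [::]|move=> _ [l _ <-]].
Qed.

Lemma dist_span_sublinear u : sublinear (dist_span u).
Proof.
have nil0 : lincomb u [::] = 0 by rewrite /lincomb big_nil.
split=> [v w|c v].
  rewrite -lerBlDr; apply: dist_span_ge => k.
  rewrite lerBlDr [leRHS]addrC -lerBlDr; apply: dist_span_ge => l; rewrite lerBlDr.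
  apply: (le_trans (dist_span_le u _ (k ++ l))).
  by rewrite lincomb_cat opprD addrACA [leRHS]addrC ler_normD.
rewrite le_eqVlt => /orP[/eqP<-|c0].
  rewrite mul0r scale0r; apply/eqP; rewrite eq_le dist_span_ge// andbT.
  by apply: (le_trans (dist_span_le _ _ [::])); rewrite nil0 subr0 normr0.
apply/eqP; rewrite eq_le; apply/andP; split.
  rewrite -ler_pdivrMl//; apply: dist_span_ge => l; rewrite ler_pdivrMl//.
  apply: (le_trans (dist_span_le _ _ [seq (c * p.1, p.2) | p <- l])).
  by rewrite lincombZ -scalerBr normrZ gtr0_norm.
apply: dist_span_ge => l; rewrite -ler_pdivlMl//.
apply: (le_trans (dist_span_le _ _ [seq (c^-1 * p.1, p.2) | p <- l])).
have {1}-> : v = c^-1 *: (c *: v) by rewrite scalerA mulVf ?gt_eqF// scale1r.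
by rewrite lincombZ -scalerBr normrZ gtr0_norm// invr_gt0.
Qed.

(** A linear functional below the distance is below the norm, hence in the dual; it is nonpositive
    at both [u n] and [- u n], hence zero there. *)
Lemma dist_span_separation u x : 0 < dist_span u x ->
  exists g, [/\ dual g, forall n, g (u n) = 0 & 0 < g x].
Proof.
move=> dx; have [g [sg gd gx]] := hahn_banach x (dist_span_sublinear u).
have gle y : g y <= `|y|.
  apply: (le_trans (gd y)); apply: (le_trans (dist_span_le u y [::])).
  by rewrite /lincomb big_nil subr0.
have g0 n c : g (c *: u n) <= 0.
  apply: (le_trans (gd _)); apply: (le_trans (dist_span_le u _ [:: (c, n)])).
  by rewrite /lincomb big_seq1 subrr normr0.
exists g; split; last by rewrite gx.
  apply: (@boundedW_dual _ _ _ 1) => // y; rewrite mul1r ler_norml gle andbT.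
  by rewrite lerNl -scalarfN// -[leRHS]normrN.
move=> n; apply/eqP; rewrite eq_le; have := g0 n 1; rewrite scale1r => -> /=.
by have := g0 n (-1); rewrite scaleN1r scalarfN// oppr_le0.
Qed.

Variable j : X -> X -> R.
Hypothesis j_scalar : forall x, scalar (j x).
Hypothesis j_norm : forall x y, `|j x y| <= `|x| * `|y|.
Hypothesis j_self : forall x, j x x = `|x| ^+ 2.

(* The functionals j d, with d a rational combination of the u n, separate the
   points of the closed span of u: if j d w = 0 with d close to w, then w = 0.
   Hence two weak ultrafilter limits of the subsequence must coincide. *)
Lemma reflexive_weak_subseq u M :
  @reflexive_space R X -> (forall n, `|u n| <= M) ->
  exists2 s : nat -> nat, forall k, (k <= s k)%N &
    cvgn (fun k => `|u (s k)|) /\ exists x, weak_cvg (u \o s) x.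
Proof.
move=> refl uM.
have [F [UF ooF]] := ultraFilterLemma (@eventually_filter).
have [x xP] := reflexive_ultrafilter_cvg refl UF uM.
have jd y : dual (j y).
  by apply: (@boundedW_dual _ _ _ `|y|) => // z; exact: j_norm.
(* Enumerates the rational combinations through their codes; invalid codes give 0. *)
pose d i := lincomb u [seq (ratr p.1, p.2) | p <- odflt [::] (@unpickle (seq (rat * nat)) i)].
(* Index 0 is reserved for the norms, so that one extraction handles them together with the
   functionals [j (d i)]. *)
pose h i n := if i is i'.+1 then j (d i') (u n) else `|u n|.
pose c i := if i is i'.+1 then j (d i') x else lim (`|u n| @[n --> F]).
have hc i : h i n @[n --> F] --> c i.
  case: i => [|i] /=; last exact: xP.
  by apply: (@ultrafilter_bounded_cvg _ _ _ _ M) => n; rewrite normr_id.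
have [s sk sc] := ultrafilter_cvg_subseq (@ultra_proper _ _ UF) ooF hc.
exists s => //; split; first by apply/cvg_ex; exists (c 0%N); exact: (sc 0%N).
exists x => g dg; apply: contrapT => ncvg.
have [e e0 infe] : exists2 e, 0 < e & forall N, exists n, (N <= n)%N /\ e <= `|g x - g (u (s n))|.
  apply: contrapT => nex; apply: ncvg; apply/cvgrPdist_lt => e e0.
  apply: contrapT => nnear; apply: nex; exists e => // N.
  apply: contrapT => nN; apply: nnear; exists N => // n /= Nn.
  by rewrite ltNge; apply/negP => en; apply: nN; exists n.
have [t tP] := choice infe.
(* If weak convergence fails at [g], the values of [g] along [v] stay [e] away from [g x]. The limit
   [y] of [v] along the same ultrafilter is then compared with [x]. *)
pose v := u \o s \o t.
have [y yP] := reflexive_ultrafilter_cvg refl UF (fun n => uM (s (t n)) : `|v n| <= M).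
have too : t n @[n --> F] --> \oo.
  move=> A [N _ NA]; apply: ooF; exists N => // n /= Nn; apply: NA => /=.
  by case: (tP n) => /(leq_trans Nn).
have jdw i : j (d i) (y - x) = 0.
  rewrite scalarfB//; apply/eqP; rewrite subr_eq0; apply/eqP.
  apply: (cvg_unique _ (yP _ (jd (d i)))) => //=.
  exact: (cvg_comp _ _ too (sc i.+1)).
have w0 : y != x.
  apply/eqP => yx; have := yP _ dg; rewrite yx => /cvgrPdist_lt/(_ _ e0).
  by move/filter_ex => [n]; rewrite ltNge; case: (tP n) => _ ->.
have nw : 0 < `|y - x| by rewrite normr_gt0 subr_eq0.
(* Off the closed span, some functional vanishes on all [u n], hence at the weak limits [x] and [y],
   yet is positive at [y - x]. *)
have [dw|dw] := ltP 0 (dist_span u (y - x)).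
  have [f [df fu]] := dist_span_separation dw.
  suff fz z w : (forall n, exists m, w n = u m) ->
      (forall g, dual g -> g (w n) @[n --> F] --> g z) -> f z = 0.
    rewrite scalarfB; last by case: df.
    rewrite (fz y v)//; last by move=> n; exists (s (t n)).
    by rewrite (fz x u)// ?subrr ?ltxx// => n; exists n.
  move=> wu /(_ _ df) fw; apply: (cvg_unique _ fw) => //.
  rewrite (_ : (fun n => _) = fun=> 0); first exact: cvg_cst.
  by apply/funext => n; have [m ->] := wu n; rewrite fu.
have e3 : 0 < `|y - x| / 4 by rewrite divr_gt0.
have [l lP] : exists l, `|y - x - lincomb u l| < `|y - x| / 4.
  apply: contrapT => nl; have : `|y - x| / 4 <= dist_span u (y - x).
    by apply: dist_span_ge => l; rewrite leNgt; apply/negP => ll; apply: nl; exists l.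
  by move/le_trans => /(_ _ dw); rewrite leNgt e3.
have [k kP] := rational_lincomb_dense u l e3.
have := jdw (pickle k); rewrite /d pickleK /=.
pose z := lincomb u [seq (ratr p.1, p.2) | p <- k]; rewrite -/z in kP *.
(* Being within half the norm of [y - x], [z] satisfies [|y - x - z| < |z|]; but [j z (y - x) = 0]
   gives [|z|^2 = |j z (y - x - z)| <= |z| |y - x - z|]. *)
have wz : `|y - x - z| < `|y - x| / 2.
  rewrite -(subrKA (lincomb u l)); apply: (le_lt_trans (ler_normD _ _)).
  have -> : `|y - x| / 2 = `|y - x| / 4 + `|y - x| / 4 by lra.
  exact: ltrD.
have nz : `|y - x - z| < `|z|.
  have := ler_normD (y - x - z) z; rewrite subrK; lra.
have z0 : 0 < `|z| by exact: le_lt_trans nz.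
have := j_norm z (y - x - z); move=> + jz0; rewrite scalarfB// j_self jz0 sub0r normrN normrX normr_id expr2 ler_pM2l//.
by rewrite leNgt nz.
Qed.

End WeakCompactness.

(** * Duality maps of B spaces *)

(** The common interface of the two kinds of B space, on which the later estimates are built. *)
Record smooth_duality {R : realType} {X : normedModType R} (j : X -> X -> R) : Prop :=
  SmoothDuality {
    duality_scalar : forall x, scalar (j x);
    duality_norm : forall x y, `|j x y| <= `|x| * `|y|;
    duality_self : forall x, j x x = `|x| ^+ 2;
    dualityN : forall x y, j (- x) y = - j x y;
    duality_unif : unif_norm_weakstar_continuous_on_bounded j }.

Lemma bounded_set_norm {R : realType} {X : normedModType R} (B : set X) :
  bounded_set B -> exists M, forall x, B x -> `|x| <= M.
Proof. by case/pinfty_ex_gt0 => M _ MB; exists M => x Bx; exact: MB. Qed.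

Section BSpaceDuality.
Context {R : realType} {X : normedModType R}.

(** Oddness comes from single-valuedness: [- j x] is a duality functional at [- x]. *)
Lemma normalized_smooth_duality (j : X -> X -> R) :
  (forall x, normalized_duality x = [set j x]) ->
  unif_norm_weakstar_continuous_on_bounded j -> smooth_duality j.
Proof.
move=> jE ju; have jx x : normalized_duality x (j x) by rewrite jE.
have jd x : dual (j x) by case: (jx x).
have nj x : dual_norm (j x) = `|x|.
  case: (jx x) => _ _ /eqP; rewrite eqrXn2// => [/eqP//|].
  exact: dual_norm_ge0.
split=> //.
- by move=> x; case: (jd x).
- by move=> x y; rewrite -(nj x); exact: dual_norm_ge.
- by move=> x; case: (jx x).
- move=> x y.
  suff : normalized_duality (- x) (fun y => - j x y) by rewrite jE => /= <-.
  split; first exact: dualN.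
  + by rewrite scalarfN; [rewrite opprK normrN; case: (jx x)|case: (jd x)].
  + by rewrite dual_normN normrN; case: (jx x).
Qed.

(** The factor [|x| / phi |x|] changes the norm [phi |x|] of the functional into [|x|]; uniform
    continuity follows by contradiction from weak sequential compactness. *)
Lemma reflexive_smooth_duality phi (jphi : X -> X -> R) :
  @reflexive_space R X -> gauge_fun phi ->
  (forall x, gauge_duality phi x = [set jphi x]) ->
  weak_weakstar_seq_continuous jphi ->
  smooth_duality (fun x y => `|x| / phi `|x| * jphi x y).
Proof.
move=> refl [phic phim phi0 _] jE jw.
have jx x : gauge_duality phi x (jphi x) by rewrite jE.
have jd x : dual (jphi x) by case: (jx x).
have phi_gt0 r : 0 < r -> 0 < phi r.
  by move=> r0; rewrite -phi0; apply: phim; rewrite // in_itv /= ?lexx// ltW.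
have cphi r : 0 <= r -> r / phi r * phi r = r.
  by rewrite le_eqVlt => /orP[/eqP<-|r0]; rewrite ?mul0r// divfK// gt_eqF// phi_gt0.
have c_ge0 r : 0 <= r -> 0 <= r / phi r.
  rewrite le_eqVlt => /orP[/eqP<-|r0]; first by rewrite mul0r.
  by rewrite divr_ge0// ltW// phi_gt0.
set j := fun x y => _.
have jN x y : j (- x) y = - j x y.
  rewrite /j normrN -mulrN; congr (_ * _).
  suff : gauge_duality phi (- x) (fun y => - jphi x y) by rewrite jE => /= <-.
  split; first exact: dualN.
  + by rewrite scalarfN; [rewrite opprK normrN; case: (jx x)|case: (jd x)].
  + by rewrite dual_normN normrN; case: (jx x).
have js x : scalar (j x) by move=> a y z; rewrite /j (jd x).1; ring.
have jn x y : `|j x y| <= `|x| * `|y|.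
  rewrite /j normrM (ger0_norm (c_ge0 _ _))//.
  apply: (@le_trans _ _ (`|x| / phi `|x| * (phi `|x| * `|y|))).
    by rewrite ler_wpM2l// ?c_ge0//; case: (jx x) => _ _ <-; exact: dual_norm_ge.
  by rewrite mulrA cphi.
have jj x : j x x = `|x| ^+ 2.
  by rewrite /j; case: (jx x) => _ -> _; rewrite mulrCA mulrC cphi// expr2.
split=> // B /bounded_set_norm[M BM] y e e0.
apply: contrapT => nunif.
(* Pairs in [B] violating uniform continuity for the moduli [1 / (n + 1)]. *)
have [|ab abP] := @choice nat (X * X)%type (fun n p => [/\ B p.1, B p.2,
    `|p.1 - p.2| < n.+1%:R^-1 & e <= `|j p.1 y - j p.2 y|]).
  move=> n; apply: contrapT => nex; apply: nunif.
  exists n.+1%:R^-1; first by rewrite invr_gt0.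
  move=> x x' Bx Bx' xx'; rewrite ltNge; apply/negP => ex'.
  by apply: nex; exists (x, x').
have aM n : `|(ab n).1| <= M by apply: BM; case: (abP n).
have [s sk [/cvg_ex[/= r ar] [x ax]]] := reflexive_weak_subseq js jn jj refl aM.
have ab0 : `|(ab (s k)).1 - (ab (s k)).2| @[k --> \oo] --> 0.
  apply: (@squeeze_cvgr _ _ _ _ (cst 0) (fun k => k.+1%:R^-1)).
  - apply: nearW => k; rewrite normr_ge0 /= ltW//.
    case: (abP (s k)) => _ _ /lt_le_trans + _; apply.
    by rewrite lef_pV2 ?posrE// ler_nat ltnS.
  - exact: cvg_cst.
  - exact: cvg_harmonic.
have br : `|(ab (s k)).2| @[k --> \oo] --> r.
  rewrite -[r]subr0; have : `|(ab (s k)).1| - (`|(ab (s k)).1| - `|(ab (s k)).2|) @[k --> \oo] --> r - 0.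
    apply: cvgB => //; apply: norm_cvg0.
    apply: (@squeeze_cvgr _ _ _ _ (cst 0) (fun k => `|(ab (s k)).1 - (ab (s k)).2|)) => //.
      by apply: nearW => k; rewrite normr_ge0 /= ler_dist_dist.
    exact: cvg_cst.
  by under eq_fun do rewrite subKr.
have bx : weak_cvg (fun k => (ab (s k)).2) x.
  move=> g dg; have [K K0 gK] := dual_bounded dg.
  rewrite -[g x]subr0.
  have : g (ab (s k)).1 - g ((ab (s k)).1 - (ab (s k)).2) @[k --> \oo] --> g x - 0.
    apply: cvgB; first exact: ax.
    apply: norm_cvg0.
    apply: (@squeeze_cvgr _ _ _ _ (cst 0) (fun k => K * `|(ab (s k)).1 - (ab (s k)).2|)) => //.
    - by apply: nearW => k; rewrite normr_ge0 /= gK.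
    - exact: cvg_cst.
    - by rewrite -(mulr0 K); exact: cvgMl_tmp.
  by under eq_fun do rewrite (scalarfB dg.1) subKr.
suff : j (ab (s k)).1 y - j (ab (s k)).2 y @[k --> \oo] --> 0.
  move=> /cvgrPdist_lt/(_ _ e0) /filter_ex[k].
  by rewrite sub0r normrN ltNge; case: (abP (s k)) => _ _ _ ->.
have r_ge0 : 0 <= r by apply: (cvgr_to_ge ar); apply: nearW.
(* The limit [r] of the norms may exceed [|x|], so the scalar factors are followed along the norms
   and [jphi] along the weak limit. For [r = 0] the factor may blow up, and [|j v y| <= |v| |y|] is
   used instead. *)
move: r_ge0; rewrite le_eqVlt => /orP[/eqP r0|r0].
  apply: norm_cvg0.
  apply: (@squeeze_cvgr _ _ _ _ (cst 0)
    (fun k => (`|(ab (s k)).1| + `|(ab (s k)).2|) * `|y|)).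
  - apply: nearW => k; rewrite normr_ge0 /= (le_trans (ler_normB _ _))// mulrDl.
    by rewrite lerD.
  - exact: cvg_cst.
  - rewrite -(mul0r `|y|); apply: cvgMr_tmp; rewrite -[0]addr0 [in X in _ --> X + X]r0.
    exact: cvgD.
have cr : (fun t => t / phi t) @ r --> r / phi r.
  apply: cvgM => //; apply: cvgV; first by rewrite gt_eqF// phi_gt0.
  have /continuous_within_itvcyP[cphi' _] := phic.
  by apply: cphi'; rewrite in_itv /= andbT.
rewrite -[0](subrr (r / phi r * jphi x y)); apply: cvgB; apply: cvgM.
- exact: (cvg_comp _ _ ar cr).
- exact: jw.
- exact: (cvg_comp _ _ br cr).
- exact: jw.
Qed.

Lemma B_space_smooth_duality : @B_space R X -> exists j : X -> X -> R, smooth_duality j.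
Proof.
case=> [[j jE ju]|[refl [phi gphi [jphi jE jw]]]].
  by exists j; exact: normalized_smooth_duality.
by exists (fun x y => `|x| / phi `|x| * jphi x y); exact: reflexive_smooth_duality.
Qed.

End BSpaceDuality.

(** * Recursive inequalities *)

Section RealSequences.
Context {R : realType}.
Implicit Types (s alpha beta gamma delta : nat -> R).

Lemma series_shift_pinfty alpha N : series alpha n @[n --> \oo] --> +oo ->
  series (fun n => alpha (n + N)%N) n @[n --> \oo] --> +oo.
Proof.
move=> /cvgryPge aoo; apply/cvgryPge => A.
have [M _ MA] := aoo (A + series alpha N).
exists M => // n /= Mn.
have := MA (n + N)%N (leq_trans Mn (leq_addr N n)).
rewrite /= -lerBrDr; congr (_ <= _).
by rewrite series_addn addrC addrA addNr add0r -{1}[N]add0n big_addn addnK.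
Qed.

Lemma series_mull_pinfty alpha c : 0 < c -> series alpha n @[n --> \oo] --> +oo ->
  series (fun n => c * alpha n) n @[n --> \oo] --> +oo.
Proof.
move=> c0 /cvgryPge aoo; apply/cvgryPge => A.
have := aoo (c^-1 * A); apply: filterS => n.
by rewrite ler_pdivrMl// /series /= mulr_sumr.
Qed.

(** From an [N] on, [delta] and the tail of [beta] are at most [e / 3]. The excess of [s] over
    [e / 3] plus the [beta] added since [N] then shrinks by [1 - gamma <= exp (- gamma)] at each
    step, and the product of these factors tends to 0. *)
Lemma xu_lemma s gamma delta beta :
  (forall n, 0 <= s n) -> (forall n, 0 <= gamma n <= 1) ->
  series gamma n @[n --> \oo] --> +oo ->
  (forall e, 0 < e -> \forall n \near \oo, delta n <= e) ->
  (forall n, 0 <= beta n) -> cvg (series beta n @[n --> \oo]) ->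
  (forall n, s n.+1 <= (1 - gamma n) * s n + gamma n * delta n + beta n) ->
  s n @[n --> \oo] --> (0 : R).
Proof.
move=> s0 g01 goo dle b0 bcvg rec; apply/cvgrPdist_lt => e e0.
have e3 : 0 < e / 3 by rewrite divr_gt0.
have [N1 _ N1P] := dle _ e3.
have [N2 _ N2P] : \forall n \near \oo, `|limn (series beta) - series beta n| < e / 3.
  by apply: cvgr_dist_lt.
pose N := maxn N1 N2.
have bndB k : series beta (N + k)%N - series beta N <= e / 3.
  have := N2P N (leq_maxr _ _); rewrite ltr_norml => /andP[_ h].
  have := nondecreasing_cvgn_le
    (nondecreasing_series (fun n _ _ => b0 n) : nondecreasing_seq (series beta)) bcvg (N + k)%N.
  by lra.
pose G k := series gamma (N + k)%N - series gamma N.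
have step k : s (N + k)%N - e / 3 - (series beta (N + k)%N - series beta N) <= expR (- G k) * s N.
  elim: k => [|k IH]; first by rewrite /G addn0 !subrr oppr0 expR0; lra.
  have B0 : 0 <= series beta (N + k)%N - series beta N.
    rewrite subr_ge0; apply: (nondecreasing_series (fun n _ _ => b0 n)); exact: leq_addr.
  rewrite addnS seriesSr.
  have GS : G k.+1 = G k + gamma (N + k)%N by rewrite /G addnS seriesSr; ring.
  rewrite GS (opprD (G k)) expRD.
  have /andP[gk0 gk1] := g01 (N + k)%N.
  have dk : gamma (N + k)%N * delta (N + k)%N <= gamma (N + k)%N * (e / 3).
    by rewrite ler_wpM2l// N1P//= (leq_trans (leq_maxl N1 N2))// leq_addr.
  have h1 := rec (N + k)%N.
  have h2 : (1 - gamma (N + k)%N) * (s (N + k)%N - e / 3 - (series beta (N + k)%N - series beta N))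
     <= (1 - gamma (N + k)%N) * (expR (- G k) * s N).
    by rewrite ler_wpM2l// subr_ge0.
  have h3 : (1 - gamma (N + k)%N) * (expR (- G k) * s N) <=
      expR (- gamma (N + k)%N) * (expR (- G k) * s N).
    rewrite ler_wpM2r ?mulr_ge0 ?expR_ge0//.
    exact: expR_ge1Dx.
  have h4 : 0 <= gamma (N + k)%N * (series beta (N + k)%N - series beta N) by rewrite mulr_ge0.
  set b := series beta (N + k)%N in h2 h4 B0 *.
  set b' := series beta N in h2 h4 B0 *.
  set E := expR (- G k) in h2 h3 *.
  set E' := expR (- gamma (N + k)%N) in h3 *.
  rewrite [E * E' * _]mulrAC [leRHS]mulrC.
  nra.
(* With [G >= 3 s_N / e], the bound [exp G >= 1 + G] gives [exp (- G) s_N < e / 3]. *)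
have [K _ KP] : \forall k \near \oo, 3 * (s N / e) + series gamma N <= series gamma k.
  by move/cvgryPge: goo; apply.
exists (N + K)%N => // n /= NKn.
have Nn : (N <= n)%N := leq_trans (leq_addr _ _) NKn.
have GP : 3 * (s N / e) <= G (n - N)%N.
  by rewrite /G subnKC// lerBrDr; exact: KP (leq_trans (leq_addl _ _) NKn).
have Eb : expR (- G (n - N)%N) * s N < e / 3.
  rewrite expRN ltr_pdivrMl ?expR_gt0//.
  have := expR_ge1Dx (G (n - N)%N); set E := expR _ => EG.
  have : (1 + 3 * (s N / e)) * (e / 3) <= E * (e / 3).
    by rewrite ler_wpM2r ?(ltW e3)//; lra.
  have -> : (1 + 3 * (s N / e)) * (e / 3) = e / 3 + s N by field; rewrite gt_eqF.
  lra.
have := step (n - N)%N; have := bndB (n - N)%N; rewrite subnKC// => h1 h2.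
by rewrite sub0r normrN ger0_norm//; lra.
Qed.

End RealSequences.

(** * Retractions onto fixed point sets *)

Section Retractions.
Context {R : realType} {X : completeNormedModType R}.
Implicit Types (C F : set X) (T f : X -> X).

Lemma convex_setP C x y t : convex_set (C : set (convex_lmodType X)) ->
  C x -> C y -> 0 <= t <= 1 -> C (t *: x + (1 - t) *: y).
Proof.
move=> cC Cx Cy t01.
have := cC x y (Itv01 (proj1 (andP t01)) (proj2 (andP t01))).
by rewrite !inE => /(_ Cx Cy).
Qed.

Lemma contraction_has_fixpoint C f k : closed C -> C !=set0 -> 0 <= k < 1 ->
  set_fun C C f -> (forall x y, C x -> C y -> `|f x - f y| <= k * `|x - y|) ->
  exists2 p, C p & p = f p.
Proof.
move=> clC C0 /andP[k0 k1] fC fk.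
pose g : {fun C >-> C} := HB.pack f (isFun.Build _ _ _ _ f fC).
suff : is_contraction g by move=> /banach_fixed_point; apply.
exists (NngNum k0); split=> //= -[x y] [/= Cx Cy]; exact: fk.
Qed.

Lemma nonexpansive_le C T x y : nonexpansive C T -> C x -> C y -> `|T x - T y| <= `|x - y|.
Proof. by case=> _ lT Cx Cy; have := lT (x, y) (conj Cx Cy); rewrite /= mul1r. Qed.

Lemma alpha_contraction_le a C f x y : alpha_contraction a C f -> C x -> C y ->
  `|f x - f y| <= a * `|x - y|.
Proof. by case=> _ _ lf Cx Cy; exact: (lf (x, y) (conj Cx Cy)). Qed.

(** The map is a [(1 - t)]-contraction of [C], so by Banach's theorem [get] selects from a nonempty
    set. *)
Lemma approx_fixpointP C T u t : closed C -> convex_set (C : set (convex_lmodType X)) ->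
  nonexpansive C T -> C u -> 0 < t < 1 ->
  C (approx_fixpoint C T u t) /\
  approx_fixpoint C T u t = t *: u + (1 - t) *: T (approx_fixpoint C T u t).
Proof.
move=> clC cC neT Cu /andP[t0 t1].
have t1' : 0 <= 1 - t by rewrite subr_ge0 ltW.
have [| | | |p Cp pE] :=
    @contraction_has_fixpoint C (fun z => t *: u + (1 - t) *: T z) (1 - t) clC.
- by exists u.
- by rewrite t1' /= gtrBl.
- by move=> z Cz; apply: convex_setP => //; [exact: neT.1|rewrite !ltW].
- move=> x y Cx Cy; rewrite opprD addrACA subrr add0r -scalerBr normrZ ger0_norm//.
  by rewrite ler_wpM2l// (nonexpansive_le neT).
by apply: (getPex (P := [set z | C z /\ z = t *: u + (1 - t) *: T z])); exists p.
Qed.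

Variables (j : X -> X -> R) (sj : smooth_duality j).

(** Near the limit all points lie in a unit ball, where uniform continuity applies. *)
Lemma duality_cvg (I : Type) (G : set_system I) (z : I -> X) (v y : X) :
  Filter G -> z @ G --> v -> j (z i) y @[i --> G] --> j v y.
Proof.
move=> FG zv; apply/cvgrPdist_lt => e e0.
have bB : bounded_set [set x | `|v - x| < 1].
  exists (`|v| + 1); split=> // M vM x /= vx; apply: ltW; apply: le_lt_trans vM.
  by rewrite -[x](subKr v) (le_trans (ler_normB _ _))// lerD2l ltW.
have [d d0 dP] := duality_unif sj bB y e0.
near=> i; apply: dP => /=; first by rewrite subrr normr0.
- by near: i; exact: cvgr_dist_lt.
- by near: i; exact: cvgr_dist_lt.
Unshelve. all: by end_near. Qed.

Lemma dualityB x y z : j x (y - z) = j x y - j x z.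
Proof. exact: (scalarfB (duality_scalar sj x)). Qed.

Lemma duality_le x y : j x y <= `|x| * `|y|.
Proof. exact: le_trans (ler_norm _) (duality_norm sj _ _). Qed.

(** Expand [|z - x|^2 = j (z - x) (z - x)] along the equation for [z] and split [T z - x] at [T x];
    the squares cancel. *)
Lemma approx_fixpoint_variational C T u t z x : nonexpansive C T -> 0 < t < 1 ->
  C z -> z = t *: u + (1 - t) *: T z -> C x ->
  t * j (x - z) (u - z) <= `|x - z| * `|x - T x|.
Proof.
move=> neT /andP[t0 t1] Cz zE Cx.
have E : j (z - x) (z - x) = t * j (z - x) (u - x) + (1 - t) * j (z - x) (T z - x).
  rewrite -!(scalarfZ (duality_scalar sj _)) -(scalarfD (duality_scalar sj _)).
  congr (j _ _); rewrite {1}zE !scalerBr addrACA -opprD -scalerDl subrKC scale1r.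
  by [].
have -> : j (x - z) (u - z) = - j (z - x) (u - z) by rewrite -opprB (dualityN sj).
have uz : j (z - x) (u - x) = j (z - x) (u - z) + `|z - x| ^+ 2.
  rewrite -(duality_self sj) -(scalarfD (duality_scalar sj _)); congr (j _ _).
  by rewrite addrA subrK.
have Tz : j (z - x) (T z - x) <= `|z - x| * (`|z - x| + `|x - T x|).
  apply: (le_trans (duality_le _ _)); rewrite ler_wpM2l//.
  rewrite -(subrKA (T x)); apply: (le_trans (ler_normD _ _)).
  by rewrite lerD ?(nonexpansive_le neT)// distrC.
rewrite (duality_self sj) uz in E; rewrite (distrC x z).
have : (1 - t) * j (z - x) (T z - x) <= (1 - t) * (`|z - x| * (`|z - x| + `|x - T x|)).
  by rewrite ler_wpM2l// subr_ge0 ltW.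
have : 0 <= t * (`|z - x| * `|x - T x|) by rewrite !mulr_ge0// ltW.
nra.
Qed.

Lemma near_right01 : \forall t \near (0 : R)^'+, 0 < t < 1.
Proof.
near=> t; apply/andP; split; near: t; first exact: nbhs_right_gt.
by apply: nbhs_right_lt.
Unshelve. all: by end_near. Qed.

(** * The limit of the approximating curve of one mapping *)

Section OneMapping.
Variables (C : set X) (T : X -> X).
Hypotheses (clC : closed C) (cC : convex_set (C : set (convex_lmodType X))).
Hypotheses (neT : nonexpansive C T) (exT : retraction_exists C T).

Lemma retraction_cvg u : C u ->
  approx_fixpoint C T u t @[t --> 0^'+] --> retraction C T u.
Proof. exact: exT. Qed.

Lemma retraction_in u : C u -> C (retraction C T u).
Proof.
move=> Cu; apply: (closed_cvg _ clC _ _ (retraction_cvg Cu)).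
by apply: filterS near_right01 => t t01; case: (approx_fixpointP clC cC neT Cu t01).
Qed.

(** Passage to the limit in [z = t u + (1 - t) T z]. *)
Lemma retraction_Fix u : C u -> Fix C T (retraction C T u).
Proof.
move=> Cu; set r := retraction C T u.
have Cr : C r by exact: retraction_in.
have zr : approx_fixpoint C T u t @[t --> 0^'+] --> r by exact: retraction_cvg.
split=> //; have t0 : t @[t --> (0 : R)^'+] --> (0 : R) by exact: cvg_at_right_filter.
have Tz : T (approx_fixpoint C T u t) @[t --> 0^'+] --> T r.
  apply/cvgrPdist_le => e e0; near=> t.
  have t01 : 0 < t < 1 by near: t; exact: near_right01.
  have [Cz _] := approx_fixpointP clC cC neT Cu t01.
  apply: (le_trans (nonexpansive_le neT Cr Cz)); near: t.
  by apply: cvgr_dist_le.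
apply: (@cvg_unique _ _ (approx_fixpoint C T u t @[t --> 0^'+])) => //.
have : t *: u + (1 - t) *: T (approx_fixpoint C T u t) @[t --> 0^'+] --> 0 *: u + (1 - 0) *: T r.
  apply: cvgD; first exact: cvgZr_tmp.
  by apply: cvgZ => //; apply: cvgB => //; exact: cvg_cst.
rewrite scale0r add0r subr0 scale1r; apply: cvg_trans; apply: near_eq_cvg.
by apply: filterS near_right01 => t t01; case: (approx_fixpointP clC cC neT Cu t01).
Unshelve. all: by end_near. Qed.

(* The sunny property of the retraction, in variational form. *)
Lemma retraction_variational u p : C u -> Fix C T p ->
  j (p - retraction C T u) (u - retraction C T u) <= 0.
Proof.
move=> Cu [Cp Tp]; set r := retraction C T u.
have zr : approx_fixpoint C T u t @[t --> 0^'+] --> r by exact: retraction_cvg.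
(* Weak-star continuity tests one fixed direction, so [u - z] is replaced by [u - r]; the error
   [z - r] is controlled in norm. *)
have jz : j (p - approx_fixpoint C T u t) (u - r) @[t --> 0^'+] --> j (p - r) (u - r).
  by apply: duality_cvg; apply: cvgB => //; exact: cvg_cst.
have nz : `|p - approx_fixpoint C T u t| * `|approx_fixpoint C T u t - r|
    @[t --> 0^'+] --> `|p - r| * `|r - r|.
  by apply: cvgM; apply: cvg_norm; apply: cvgB => //; exact: cvg_cst.
rewrite -[leRHS](mulr0 `|p - r|) -(@normr0 _ X) -(subrr r).
apply: ler_cvg_to jz nz _; apply: filterS near_right01 => t t01.
have [Cz zE] := approx_fixpointP clC cC neT Cu t01.
have := approx_fixpoint_variational neT t01 Cz zE Cp.
rewrite Tp subrr normr0 mulr0 pmulr_rle0; last by case/andP: t01.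
move: (approx_fixpoint C T u t) => z jneg.
have -> : u - r = u - z + (z - r) by rewrite subrKA.
rewrite (scalarfD (duality_scalar sj _)).
by have := duality_le (p - z) (z - r); lra.
Qed.

End OneMapping.

(** * Dependence of the retraction on the fixed point set alone *)

Section Representation.
Variables (C F : set X).
Hypotheses (clC : closed C) (cC : convex_set (C : set (convex_lmodType X))).

(** Each retracted point is tested in the variational inequality of the other; the sum gives
    [|r - s|^2 <= j (r - s) (u - v)]. The case [T1 = T2] is nonexpansiveness, the case [u = v]
    independence of the representing mapping. *)
Lemma retraction_le T1 T2 u v : represents C F T1 -> represents C F T2 -> C u -> C v ->
  `|retraction C T1 u - retraction C T2 v| <= `|u - v|.
Proof.
move=> [ne1 F1 ex1] [ne2 F2 ex2] Cu Cv.
have FixE : Fix C T1 = Fix C T2 by rewrite F1 F2.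
have := retraction_variational clC cC ne1 ex1 Cu; rewrite FixE.
move=> /(_ _ (retraction_Fix clC cC ne2 ex2 Cv)).
have := retraction_variational clC cC ne2 ex2 Cv; rewrite -FixE.
move=> /(_ _ (retraction_Fix clC cC ne1 ex1 Cu)).
move: (retraction C T1 u) (retraction C T2 v) => r s.
rewrite -(opprB r s) (dualityN sj) !dualityB => h2 h1.
have h3 := duality_le (r - s) (u - v).
have : `|r - s| ^+ 2 <= `|r - s| * `|u - v|.
  by rewrite -(duality_self sj) dualityB; move: h3; rewrite dualityB; lra.
have [->|rs] := eqVneq (r - s) 0; first by rewrite normr0.
by rewrite expr2 ler_pM2l// normr_gt0.
Qed.

(** One representing mapping suffices: [retraction_le] carries the fixed point to any other one, and
    the contraction [f] gives uniqueness. *)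
Lemma represents_is_QF T f a q : represents C F T -> alpha_contraction a C f -> C q ->
  q = retraction C T (f q) -> is_QF C F f q.
Proof.
move=> rT fc Cq qE; split; first by exists T.
have fC : set_fun C C f by case: fc.
move=> S rS; apply/seteqP; split=> [p [Cp pE]|_ ->] /=.
  have := retraction_le rS rT (fC _ Cp) (fC _ Cq).
  rewrite -qE -[X in `|X - _|]/((retraction C S \o f) p) pE => pq.
  have := le_trans pq (alpha_contraction_le fc Cp Cq).
  have [//|npq] := eqVneq p q.
  rewrite -[leLHS]mul1r ler_pM2r ?normr_gt0 ?subr_eq0// leNgt.
  by case: fc => /andP[_ ->].
split=> //=; apply/eqP; rewrite -subr_eq0 -normr_le0 [X in _ - X]qE.
by apply: le_trans (retraction_le rS rT (fC _ Cq) (fC _ Cq)) _; rewrite subrr normr0.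
Qed.

End Representation.

End Retractions.

(** * The iteration *)

Section Compositions.
Context {R : realType} {X : completeNormedModType R} (C : set X).

Lemma compose_from_nonexpansive (T : nat -> X -> X) n k :
  (forall m, nonexpansive C (T m)) -> nonexpansive C (compose_from T n k).
Proof.
move=> neT; elim: k => [|k IH] /=.
  by split=> // -[x y] [Cx Cy] /=; rewrite mul1r.
split; first by move=> x Cx; apply: (neT _).1; exact: IH.1.
move=> [x y] [/= Cx Cy]; rewrite mul1r.
apply: le_trans (nonexpansive_le (neT _) _ _) _; [exact: IH.1|exact: IH.1|].
exact: nonexpansive_le IH Cx Cy.
Qed.

(** Leaves only [N] distinct compositions, so that a single [t] can later serve all [n]. *)
Lemma compose_from_modn (T : nat -> X -> X) N n k :
  (forall m, T (m + N)%N = T m) -> compose_from T n k = compose_from T (n %% N) k.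
Proof.
move=> perT; have perTm m i : T (m + i * N)%N = T m.
  by elim: i => [|i IH]; rewrite ?mul0n ?addn0// mulSnr addnA perT.
elim: k => [//|k IH] /=; rewrite IH; congr (_ \o _).
by rewrite -(perTm (n %% N + k.+1)%N (n %/ N)%N) addnAC [(_ + _ * N)%N]addnC -divn_eq.
Qed.

End Compositions.

Section Iteration.
Context {R : realType} {X : completeNormedModType R}.
Variables (C : set X) (T : nat -> X -> X) (f : X -> X) (a : R).
Variables (alpha : nat -> R) (x : nat -> X).
Hypotheses (cC : convex_set (C : set (convex_lmodType X))).
Hypotheses (neT : forall n, nonexpansive C (T n)) (f_contr : alpha_contraction a C f).
Hypotheses (alpha01 : forall n, 0 < alpha n < 1).
Hypotheses (alpha_cvg0 : alpha n @[n --> \oo] --> (0 : R)).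
Hypotheses (alpha_div : series alpha n @[n --> \oo] --> +oo).
Hypotheses (x0_in : C (x 0%N)).
Hypotheses (x_rec : forall n,
  x n.+1 = alpha n *: f (x n) + (1 - alpha n) *: T n (x n)).

Let alpha_gt0 n : 0 < alpha n. Proof. by case/andP: (alpha01 n). Qed.
Let alpha_lt1 n : alpha n < 1. Proof. by case/andP: (alpha01 n). Qed.
Let a_gt0 : 0 < a. Proof. by case: f_contr => /andP[]. Qed.
Let a_lt1 : a < 1. Proof. by case: f_contr => /andP[]. Qed.
Let fC : set_fun C C f. Proof. by case: f_contr. Qed.

Lemma iterate_in n : C (x n).
Proof.
elim: n => // n IH; rewrite x_rec; apply: convex_setP => //; first exact: fC.
  exact: (neT n).1.
by rewrite !ltW.
Qed.

Lemma iterate_bounded p : C p -> (forall n, T n p = p) ->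
  exists2 M, 0 < M & forall n,
    [/\ `|x n - p| <= M, `|f (x n) - p| <= M & `|T n (x n) - p| <= M].
Proof.
(* Chosen so that [|f p - p| <= (1 - a) M], which keeps the iterates in the ball of radius [M] about
   [p]; the [+ 1] makes [M] positive. *)
move=> Cp Tp; pose M := `|x 0%N - p| + `|f p - p| / (1 - a) + 1.
have a1 : 0 < 1 - a by rewrite subr_gt0.
have fp0 : 0 <= `|f p - p| / (1 - a) by rewrite divr_ge0// ltW.
have fpM : `|f p - p| <= (1 - a) * M.
  by rewrite -ler_pdivrMl// mulrC /M; have := normr_ge0 (x 0%N - p); lra.
have fM n : `|x n - p| <= M -> `|f (x n) - p| <= M.
  move=> xM; rewrite -(subrKA (f p)); apply: le_trans (ler_normD _ _) _.
  have := alpha_contraction_le f_contr (iterate_in n) Cp.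
  have : a * `|x n - p| <= a * M by rewrite ler_wpM2l// ltW.
  lra.
have TM n : `|x n - p| <= M -> `|T n (x n) - p| <= M.
  by apply: le_trans; rewrite -{1}(Tp n); exact: nonexpansive_le (neT n) (iterate_in n) Cp.
have xM n : `|x n - p| <= M.
  elim: n => [|n IH]; first by rewrite /M; lra.
  have -> : x n.+1 - p = alpha n *: (f (x n) - p) + (1 - alpha n) *: (T n (x n) - p).
    by rewrite x_rec !scalerBr addrACA -opprD -scalerDl subrKC scale1r.
  apply: le_trans (ler_normD _ _) _; rewrite !normrZ !gtr0_norm ?subr_gt0//.
  have := fM _ IH; have := TM _ IH; have := alpha_gt0 n; have := alpha_lt1 n; nra.
exists M; first by rewrite /M; have := normr_ge0 (x 0%N - p); lra.
by move=> n; split; [|apply: fM|apply: TM].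
Qed.

(** * Asymptotic regularity of the iterates *)

Section ShiftedIterates.
Variables (p : X) (N : nat).
Hypotheses (Cp : C p) (Tp : forall n, T n p = p) (perT : forall n, T (n + N)%N = T n).
Hypotheses (alpha_reg :
  cvg (series (fun n => `|alpha (n + N)%N - alpha n|) n @[n --> \oo])
  \/ alpha (n + N)%N / alpha n @[n --> \oo] --> (1 : R)).

(** By periodicity both iterates are moved by the same mapping, so their distance contracts by
    [1 - (1 - a) alpha_{n+N}] up to [2 M |alpha_{n+N} - alpha_n|]. This error is summable in one
    case and of the form [gamma delta] with [delta] tending to 0 in the other. *)
Lemma iterate_shift_cvg0 : `|x (n + N)%N - x n| @[n --> \oo] --> (0 : R).
Proof.
have [M M0 xM] := iterate_bounded Cp Tp.
have a1 : 0 < 1 - a by rewrite subr_gt0.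
pose D n := `|alpha (n + N)%N - alpha n|.
have rec n : `|x (n.+1 + N)%N - x n.+1| <=
    (1 - (1 - a) * alpha (n + N)%N) * `|x (n + N)%N - x n| + 2 * M * D n.
  rewrite addSn !x_rec perT.
  move: (alpha01 (n + N)%N); set b := alpha (n + N)%N => b01.
  (* Regrouping by the weight [b] isolates the change of weight; [p] is inserted to bound the vector
     it multiplies by [2 M]. *)
  have -> : b *: f (x (n + N)%N) + (1 - b) *: T n (x (n + N)%N)
      - (alpha n *: f (x n) + (1 - alpha n) *: T n (x n)) =
      b *: (f (x (n + N)%N) - f (x n)) + (1 - b) *: (T n (x (n + N)%N) - T n (x n))
      + (b - alpha n) *: ((f (x n) - p) - (T n (x n) - p)).
    move: (f (x (n + N)%N)) (T n (x (n + N)%N)) (f (x n)) (T n (x n)) => u v w z.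
    have -> : w - p - (z - p) = w - z by rewrite opprB subrKA.
    rewrite (scalerBr (b - alpha n)) opprD addrACA [RHS]addrACA; congr (_ + _).
      by rewrite scalerBr scalerBl addrA subrK.
    by rewrite scalerBr -addrA -opprD -scalerDl addrA subrK.
  apply: le_trans (ler_normD _ _) _; apply: lerD; last first.
    rewrite normrZ mulrC ler_wpM2r// (le_trans (ler_normB _ _))//.
    by case: (xM n) => _; lra.
  apply: le_trans (ler_normD _ _) _; rewrite !normrZ.
  have /andP[b0 b1] := b01; rewrite !gtr0_norm ?subr_gt0//.
  have := alpha_contraction_le f_contr (iterate_in (n + N)) (iterate_in n).
  have := nonexpansive_le (neT n) (iterate_in (n + N)) (iterate_in n).
  nra.
have g01 n : 0 <= (1 - a) * alpha (n + N)%N <= 1.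
  have := alpha_gt0 (n + N); have := alpha_lt1 (n + N); have := a_gt0.
  by move=> *; apply/andP; split; nra.
have goo : series (fun n => (1 - a) * alpha (n + N)%N) n @[n --> \oo] --> +oo.
  exact/series_mull_pinfty/series_shift_pinfty.
case: alpha_reg => [Dcvg|alpha1].
  apply: (@xu_lemma _ _ (fun n => (1 - a) * alpha (n + N)%N) (fun=> 0) (fun n => 2 * M * D n)) => //.
  - by move=> e e0; apply: nearW => n; exact: ltW.
  - by move=> n; rewrite /D; do !apply: mulr_ge0 => //; exact: ltW.
  - rewrite (_ : series _ = fun n => 2 * M * series D n); last first.
      by apply/funext => n; rewrite /series /= mulr_sumr.
    exact: is_cvgMl_tmp.
  - by move=> n; rewrite mulr0 addr0.
(* Solved from [gamma n * delta n = 2 * M * D n] in absolute value. *)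
pose delta n := 2 * M / (1 - a) * `|1 - alpha n / alpha (n + N)%N|.
have delta0 : delta n @[n --> \oo] --> (0 : R).
  rewrite -(mulr0 (2 * M / (1 - a))); apply: cvgMl_tmp.
  rewrite -(@normr0 _ R) -[X in `|X|](subrr 1); apply: cvg_norm.
  apply: cvgB; first exact: cvg_cst.
  have : (alpha (n + N)%N / alpha n)^-1 @[n --> \oo] --> (1^-1 : R).
    exact: cvgV (oner_neq0 R) alpha1.
  rewrite invr1.
  by under eq_fun do rewrite invf_div.
apply: (@xu_lemma _ _ (fun n => (1 - a) * alpha (n + N)%N) delta (fun=> 0)) => //.
- by move=> e e0; move/cvgrPdist_le: delta0 => /(_ e e0); apply: filterS => n;
     rewrite sub0r normrN => /(le_trans (ler_norm _)).
- by rewrite /series /=; under eq_fun do rewrite big1//; exact: is_cvg_cst.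
- move=> n; rewrite addr0; apply: le_trans (rec n) _; rewrite lerD2l le_eqVlt; apply/orP; left.
  apply/eqP; rewrite /delta /D.
  have -> : alpha (n + N)%N - alpha n = alpha (n + N)%N * (1 - alpha n / alpha (n + N)%N).
    by rewrite mulrBr mulr1 mulrCA divff ?mulr1// gt_eqF.
  rewrite normrM gtr0_norm//; field; by rewrite gt_eqF.
Qed.

(** Each iterate differs from the image under its mapping by [alpha] times a bounded vector, and
    later nonexpansive mappings do not enlarge the error. As the composition begins with [T n.+1],
    it is applied to [x n.+1]. *)
Lemma iterate_compose_cvg0 k :
  `|x (n + k).+1 - compose_from T n k (x n.+1)| @[n --> \oo] --> (0 : R).
Proof.
have [M M0 xM] := iterate_bounded Cp Tp.
elim: k => [|k IH].
  under eq_fun do rewrite addn0 subrr normr0; exact: cvg_cst.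
apply: (@squeeze_cvgr _ _ _ _ (cst 0) (fun n => alpha (n + k.+1)%N * (2 * M)
   + `|x (n + k).+1 - compose_from T n k (x n.+1)|)).
- apply: nearW => n; rewrite normr_ge0 /= x_rec addnS.
  set m := (n + k).+1; set y := compose_from _ _ _ _.
  have -> : alpha m *: f (x m) + (1 - alpha m) *: T m (x m) - T m y =
      alpha m *: ((f (x m) - p) - (T m (x m) - p)) + (T m (x m) - T m y).
    have -> : f (x m) - p - (T m (x m) - p) = f (x m) - T m (x m) by rewrite opprB subrKA.
    by rewrite scalerBr scalerBl scale1r !addrA; congr (_ - _); rewrite addrAC.
  apply: le_trans (ler_normD _ _) _; apply: lerD.
    rewrite normrZ gtr0_norm// ler_pM2l// (le_trans (ler_normB _ _))//.
    by case: (xM m) => _; lra.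
  apply: nonexpansive_le (neT m) (iterate_in _) _.
  exact: (compose_from_nonexpansive _ _ neT).1 (iterate_in _).
- exact: cvg_cst.
- rewrite -[0]addr0 -{1}[0](mul0r (2 * M)); apply: cvgD => //; apply: cvgMr_tmp.
  by have := alpha_cvg0; rewrite -(cvg_shiftn k.+1).
Qed.

Lemma iterate_almost_fixed :
  `|x n.+1 - compose_from T n N (x n.+1)| @[n --> \oo] --> (0 : R).
Proof.
apply: (@squeeze_cvgr _ _ _ _ (cst 0) (fun n => `|x (n.+1 + N)%N - x n.+1|
   + `|x (n + N).+1 - compose_from T n N (x n.+1)|)).
- apply: nearW => n; rewrite normr_ge0 /= addSn (distrC _ (x n.+1)).
  by rewrite -(subrKA (x (n + N).+1)) ler_normD.
- exact: cvg_cst.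
- rewrite -[0]addr0; apply: cvgD; last exact: iterate_compose_cvg0.
  by have := iterate_shift_cvg0; rewrite -cvg_shiftS.
Qed.

End ShiftedIterates.

(** * Strong convergence of the iterates *)

Section StrongConvergence.
Variables (j : X -> X -> R) (sj : smooth_duality j) (clC : closed C).
Variables (F : set X) (q : X) (N : nat) (N_gt0 : (0 < N)%N).
Hypotheses (Fq : F q) (FT : forall p n, F p -> T n p = p) (perT : forall n, T (n + N)%N = T n).
Hypotheses (repW : forall n, represents C F (compose_from T n N)).
Hypotheses (qE : forall n, q = retraction C (compose_from T n N) (f q)).
Hypotheses (alpha_reg :
  cvg (series (fun n => `|alpha (n + N)%N - alpha n|) n @[n --> \oo])
  \/ alpha (n + N)%N / alpha n @[n --> \oo] --> (1 : R)).

Let Cq : C q.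
Proof. by case: (repW 0) => _ FixE _; move: Fq; rewrite -FixE => -[]. Qed.

(** The point [q] is replaced by the approximating point [z n t], for which the variational
    inequality holds at [x n.+1]; three errors of [e / 3] result. *)
Lemma iterate_limsup_variational e : 0 < e ->
  \forall n \near \oo, j (x n.+1 - q) (f q - q) <= e.
Proof.
move=> e0; have Cfq : C (f q) by exact: fC.
have Tq n : T n q = q by exact: FT.
have [M M0 xM] := iterate_bounded Cq Tq.
have e3 : 0 < e / 3 by rewrite divr_gt0.
have M1 : 0 < M + 1 by rewrite addr_gt0.
(* Radius [M + 1] holds both [x n.+1 - q] and [x n.+1 - z n t]. *)
have bB : bounded_set [set v : X | `|v| <= M + 1].
  exists (M + 1); split; first exact: gtr0_real.
  move=> K MK v /= /le_trans; apply; exact: ltW.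
have [d d0 dP] := duality_unif sj bB (f q - q) e3.
pose z n t := approx_fixpoint C (compose_from T n N) (f q) t.
(* The three bounds serve, in turn, uniform continuity, the estimate [|x n.+1 - z n t| <= M + 1],
   and the term in direction [z n t - q]. Uniformity in [n] comes from the finitely many residues
   modulo [N]. *)
have [t [t01 zt]] : exists t, 0 < t < 1 /\ forall n,
    `|q - z n t| < Num.min d (Num.min 1 (e / 3 / (M + 1))).
  have zt : \forall t \near (0 : R)^'+, forall n : 'I_N,
      `|q - z n t| < Num.min d (Num.min 1 (e / 3 / (M + 1))).
    apply: filter_forall => n; have [neW _ exW] := repW n.
    have /cvgrPdist_lt := retraction_cvg exW Cfq; rewrite -qE; apply.
    by rewrite !lt_min d0 ltr01 divr_gt0.
  have [t [t01 {}zt]] := filter_ex (filterI (@near_right01 R) zt).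
  exists t; split=> // n.
  by have := zt (Ordinal (ltn_pmod n N_gt0)); rewrite /z (compose_from_modn n N perT).
have t0 : 0 < t by case/andP: t01.
have := iterate_almost_fixed Cq Tq perT alpha_reg.
(* With [t] now fixed, [n] is taken large enough to beat the factor [t] of the variational
   inequality. *)
have et : 0 < t * (e / 3 / (M + 1)) by rewrite mulr_gt0// divr_gt0.
move=> /cvgrPdist_lt/(_ _ et); apply: filterS => n; rewrite sub0r normrN normr_id => xW.
have := zt n; rewrite !lt_min => /and3P[zd z1 ze].
have [neW _ _] := repW n.
have [Cz zE] := approx_fixpointP clC cC neW Cfq t01.
have := approx_fixpoint_variational sj neW t01 Cz zE (iterate_in n.+1).
rewrite -/(z n t) in Cz zE *; move: (z n t) zd z1 ze Cz zE => w wd w1 we Cw wE.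
have xw : `|x n.+1 - w| <= M + 1.
  rewrite -(subrKA q) (le_trans (ler_normD _ _))// lerD ?(ltW w1)//.
  by case: (xM n.+1).
have xq : `|x n.+1 - q| <= M + 1 by case: (xM n.+1) => h _ _; rewrite (le_trans h)// lerDl.
move=> h.
have {}h : j (x n.+1 - w) (f q - w) <= e / 3.
  rewrite -(ler_pM2l t0); apply: le_trans h _.
  apply: (@le_trans _ _ ((M + 1) * (t * (e / 3 / (M + 1))))).
    by rewrite ler_pM// ltW.
  by rewrite le_eqVlt; apply/orP; left; apply/eqP; field; rewrite gt_eqF.
have h2 : j (x n.+1 - w) (w - q) <= e / 3.
  apply: le_trans (duality_le sj _ _) _; rewrite (distrC w).
  rewrite -(divfK (lt0r_neq0 M1) (e / 3)) mulrC ler_pM//; exact: ltW.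
have := dP (x n.+1 - q) (x n.+1 - w) xq xw.
have -> : x n.+1 - q - (x n.+1 - w) = - (q - w) by rewrite opprB addrC subrKA opprB.
rewrite normrN => /(_ wd)/ltW/ler_normlW.
have <- : j (x n.+1 - w) (f q - w) + j (x n.+1 - w) (w - q) = j (x n.+1 - w) (f q - q).
  by rewrite -(scalarfD (duality_scalar sj _)) subrKA.
lra.
Qed.

(** With [v = x n.+1 - q], expand [|v|^2 = j v v] along the recursion. AM-GM on [|v| |x n - q|] lets
    half be absorbed on the left, which leaves the recursion of [xu_lemma] for the squared
    distances. *)
Lemma iterate_cvg : x n @[n --> \oo] --> q.
Proof.
have Tq n : T n q = q by exact: FT.
have a1 : 0 < 1 - a by rewrite subr_gt0.
pose L n := Num.max 0 (j (x n.+1 - q) (f q - q)).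
have sq0 : `|x n - q| ^+ 2 @[n --> \oo] --> (0 : R).
  apply: (@xu_lemma _ _ (fun n => (1 - a) * alpha n) (fun n => 2 / (1 - a) * L n) (fun=> 0)).
  - by move=> n; exact: sqr_ge0.
  - move=> n; have := alpha_gt0 n; have := alpha_lt1 n; have := a_gt0.
    by move=> *; apply/andP; split; nra.
  - exact: series_mull_pinfty.
  (* The tolerance [(1 - a) / 2 * e] undoes the factor [2 / (1 - a)]. *)
  - move=> e e0; have := @iterate_limsup_variational ((1 - a) / 2 * e).
    rewrite !mulr_gt0 ?divr_gt0// => /(_ isT); apply: filterS => n jn.
    rewrite -[2 / _]invf_div ler_pdivrMl ?divr_gt0// ge_max jn andbT.
    by rewrite mulr_ge0 ?divr_ge0// ltW.
  - by [].
  - by rewrite /series /=; under eq_fun do rewrite big1//; exact: is_cvg_cst.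
  - move=> n; rewrite addr0.
    have -> : (1 - a) * alpha n * (2 / (1 - a) * L n) = 2 * alpha n * L n.
      by field; rewrite gt_eqF.
    set v := x n.+1 - q; have al0 := alpha_gt0 n; have al1 := alpha_lt1 n.
    have vE : `|v| ^+ 2 = alpha n * (j v (f (x n) - f q) + j v (f q - q))
        + (1 - alpha n) * j v (T n (x n) - q).
      rewrite -(scalarfD (duality_scalar sj _)) subrKA -!(scalarfZ (duality_scalar sj _)).
      rewrite -(scalarfD (duality_scalar sj _)) -(duality_self sj); congr (j _ _).
      by rewrite /v x_rec !scalerBr addrACA -opprD -scalerDl subrKC scale1r.
    have vL : j v (f q - q) <= L n by rewrite /L le_max lexx orbT.
    have L0 : 0 <= L n by rewrite /L le_max lexx.
    have v1 : j v (f (x n) - f q) <= `|v| * (a * `|x n - q|).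
      apply: le_trans (duality_le sj _ _) _; rewrite ler_wpM2l//.
      exact: alpha_contraction_le f_contr (iterate_in n) Cq.
    have v2 : j v (T n (x n) - q) <= `|v| * `|x n - q|.
      apply: le_trans (duality_le sj _ _) _; rewrite ler_wpM2l// -{1}(Tq n).
      exact: nonexpansive_le (neT n) (iterate_in n) Cq.
    set r := `|x n - q| in v1 v2 *; set s := `|v| in vE v1 v2 *.
    have h1 : s ^+ 2 <= (1 - (1 - a) * alpha n) * (s * r) + alpha n * L n.
      have : alpha n * (j v (f (x n) - f q) + j v (f q - q)) <=
          alpha n * (s * (a * r) + L n) by rewrite ler_pM2l// lerD.
      have : (1 - alpha n) * j v (T n (x n) - q) <= (1 - alpha n) * (s * r).
        by rewrite ler_pM2l// subr_gt0.
      by rewrite vE; lra.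
    have c0 : 0 <= 1 - (1 - a) * alpha n by have := a_gt0; nra.
    have c1 : 1 - (1 - a) * alpha n <= 1 by nra.
    move: (1 - (1 - a) * alpha n) c0 c1 h1 => c c0 c1 h1.
    (* AM-GM: 2 s r <= s^2 + r^2 *)
    have h2 : c * (2 * (s * r)) <= c * (s ^+ 2 + r ^+ 2).
      by rewrite ler_wpM2l//; have := sqr_ge0 (s - r); rewrite sqrrB mulr_natl; lra.
    have h3 : c * s ^+ 2 <= 1 * s ^+ 2 by rewrite ler_wpM2r// sqr_ge0.
    lra.
apply/cvgrPdist_lt => e e0; move/cvgrPdist_lt: sq0 => /(_ (e ^+ 2)).
rewrite exprn_gt0// => /(_ isT); apply: filterS => n.
by rewrite sub0r normrN normrX normr_id distrC ltr_pXn2r ?nnegrE// (ltW e0).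
Qed.

End StrongConvergence.

End Iteration.

(** * Existence of the limit point and convergence to it *)

Theorem theorem15 (R : realType) (X : completeNormedModType R)
    (X_B : B_space X)
    (C : set X) (C_ne : C !=set0) (C_closed : closed C)
    (C_convex : convex_set (C : set (convex_lmodType X)))
    (N : nat) (N_gt0 : (0 < N)%N) (Q : 'I_N -> X -> X)
    (Q_nonexp : forall l, nonexpansive C (Q l))
    (F_ne : \bigcap_l Fix C (Q l) !=set0)
    (F_eq : forall n : nat,
      \bigcap_l Fix C (Q l) = Fix C (compose_from (cyclic_family N_gt0 Q) n N))
    (R_ex : forall n : nat,
      retraction_exists C (compose_from (cyclic_family N_gt0 Q) n N))
    (f : X -> X) (a : R) (f_contr : alpha_contraction a C f)
    (alpha : nat -> R)
    (alpha01 : forall n, 0 < alpha n < 1)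
    (alpha_cvg0 : alpha n @[n --> \oo] --> (0 : R))
    (alpha_div : series alpha n @[n --> \oo] --> +oo)
    (alpha_reg :
      cvg (series (fun n => `|alpha (n + N)%N - alpha n|) n @[n --> \oo])
      \/ alpha (n + N)%N / alpha n @[n --> \oo] --> (1 : R))
    (x : nat -> X) (x0_in : C (x 0%N))
    (x_rec : forall n, x n.+1 =
      alpha n *: f (x n) + (1 - alpha n) *: cyclic_family N_gt0 Q n (x n)) :
  exists2 q, is_QF C (\bigcap_l Fix C (Q l)) f q & x n @[n --> \oo] --> q.
Proof.
have [j sj] := B_space_smooth_duality X_B.
set F := \bigcap_l Fix C (Q l) in F_ne F_eq *.
set T := cyclic_family N_gt0 Q in F_eq R_ex x_rec *.
have neT n : nonexpansive C (T n) by exact: Q_nonexp.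
have perT n : T (n + N)%N = T n.
  by rewrite /T /cyclic_family; congr Q; apply: val_inj; rewrite /= modnDr.
have FT p n : F p -> T n p = p by move=> /(_ (Ordinal (ltn_pmod n N_gt0)) I)[].
have repW n : represents C F (compose_from T n N).
  by split; [exact: compose_from_nonexpansive|rewrite -F_eq|exact: R_ex].
have fC : set_fun C C f by case: f_contr.
(* The composition at [n = 0] defines [q]: its retraction is nonexpansive, so following [f] by it
   gives an [a]-contraction. *)
have [| |x1 y1 Cx1 Cy1|q Cq qE] :=
    @contraction_has_fixpoint _ _ C (retraction C (compose_from T 0 N) \o f) a C_closed C_ne.
- by case: f_contr => /andP[/ltW-> ->].
- move=> y Cy /=; apply: retraction_in => //; last exact: fC.
    exact: compose_from_nonexpansive.
- apply: le_trans (alpha_contraction_le f_contr Cx1 Cy1).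
  exact: (retraction_le sj C_closed C_convex (repW 0%N) (repW 0%N) (fC _ Cx1) (fC _ Cy1)).
have Fq : F q.
  rewrite qE (F_eq 0%N); apply: retraction_Fix => //; last exact: fC.
  exact: compose_from_nonexpansive.
(* All the compositions have fixed point set [F], so their retractions agree and [q] solves the
   equation for each [n]. *)
have qEn n : q = retraction C (compose_from T n N) (f q).
  apply/eqP; rewrite {1}qE -subr_eq0 -normr_le0.
  apply: le_trans (retraction_le sj C_closed C_convex (repW 0%N) (repW n) (fC _ Cq) (fC _ Cq)) _.
  by rewrite subrr normr0.
exists q.
  exact: (represents_is_QF sj C_closed C_convex (repW 0%N) f_contr Cq qE).
exact: (iterate_cvg C_convex neT f_contr alpha01 alpha_cvg0 alpha_div x0_in x_rec sj C_closed N_gt0 Fq FT perT repW qEn alpha_reg).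
Qed.
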